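(* Let $\Delta$ and $\Gamma$ be finite simplicial graphs with $V(\Delta)=\{x_1,\dots,x_n\}$ and $V(\Gamma)=\{y_1,\dots,y_M\}$, and let $K$ be the number of connected components of $\Delta$. Put $R=4Kn^2M^{K+1}$. If $\Delta$ is an induced subgraph of the extension graph $\Gamma^e$, then $\Delta$ is an induced subgraph of $B(\Gamma^e,R)$, the induced subgraph of $\Gamma^e$ spanned by the finite vertex set $\{v y_i v^{-1} \mid 1\le i\le M,\ v\in\mathbb{G}(\Gamma),\ |v|\le R\}$.
   Context: For a finite simplicial graph $\Gamma$, the partially commutative group (right-angled Artin group) is $\mathbb{G}(\Gamma)=\langle V(\Gamma)\mid [x,y]=1 \text{ for } (x,y)\in E(\Gamma)\rangle$. $|v|$ denotes the word length of $v$ with respect to the generating set $V(\Gamma)$. The extension graph $\Gamma^e$ has as vertices all conjugates $g^{-1}xg$ ($x\in V(\Gamma)$, $g\in\mathbb{G}(\Gamma)$) of generators, with an edge between two distinct vertices iff they commute in $\mathbb{G}(\Gamma)$. $\Lambda$ is an induced subgraph of $\Gamma$ if there is an injective map $i:V(\Lambda)\to V(\Gamma)$ with $(v,v')\in E(\Lambda)$ iff $(i(v),i(v'))\in E(\Gamma)$. *)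

(* Defs.v *)
(* Right-angled Artin groups encoded by words modulo the
   congruence generated by free cancellation and commutation of adjacent
   generators. *)
From Stdlib Require Import Relation_Operators.
From mathcomp Require Import all_boot.
Set Implicit Arguments. Unset Strict Implicit. Unset Printing Implicit Defensive.

Section RAAG.
Variable T : finType.
Variable e : rel T.

(* a letter (x, false) is the generator x, (x, true) is its inverse *)
Definition letter := (T * bool)%type.
Definition word := seq letter.

Definition inv_word (w : word) : word := rev (map (fun l => (l.1, ~~ l.2)) w).

Inductive raag_step : word -> word -> Prop :=
| step_cancel (u w : word) (x : T) (b : bool) :
    raag_step (u ++ [:: (x, b); (x, ~~ b)] ++ w) (u ++ w)
| step_comm (u w : word) (x y : T) (b c : bool) :
    e x y -> raag_step (u ++ [:: (x, b); (y, c)] ++ w) (u ++ [:: (y, c); (x, b)] ++ w).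

Definition weq (u w : word) : Prop := clos_refl_sym_trans word raag_step u w.

Definition ext_vertex (w : word) : Prop :=
  exists (g : word) (x : T), weq w (inv_word g ++ [:: (x, false)] ++ g).

Definition ext_adj (a b : word) : Prop := ~ weq a b /\ weq (a ++ b) (b ++ a).

(* vertices of B(Gamma^e, R): v y v^-1 with |v| <= R, i.e. v represented by
   some word of length <= R *)
Definition ball_vertex (R : nat) (w : word) : Prop :=
  exists (v : word) (y : T), size v <= R /\ weq w (v ++ [:: (y, false)] ++ inv_word v).
End RAAG.

Definition simple_graph (T : finType) (r : rel T) : Prop :=
  ssrbool.symmetric r /\ ssrbool.irreflexive r.

Definition induced_in_ext (D : finType) (eD : rel D) (T : finType) (e : rel T)
  (P : word T -> Prop) : Prop :=
  exists f : D -> word T,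
    (forall a, ext_vertex e (f a) /\ P (f a)) /\
    (forall a b, weq e (f a) (f b) -> a = b) /\
    (forall a b, eD a b <-> ext_adj e (f a) (f b)).

Definition num_components (D : finType) (eD : rel D) : nat :=
  n_comp (connect eD) D.

(* Main.v *)
(** Vertices of the extension graph are encoded by left cosets: [g a g^-1]
    depends only on [g G(St a)], and two vertices are adjacent iff their generators
    are and the cosets meet. If two cosets do not meet, a reduced word [w] from one
    to the other contains a chain of at most [M] letters, consecutive ones not
    commuting, which prevents [w] from lying in [G(St a) G(St b)]. Each letter
    of the chain marks a hyperplane of the Cayley graph; in total at most
    [n^2 M] hyperplanes are marked. For each generator [z], the half-spaces of the
    marked hyperplanes labelled [z] that avoid [1] form a laminar family; let
    [F z g] be the index, in a linear extension, of the last one containing [g].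
    The map [phi] replacing each letter [z] of a path by [z] to the increment
    of [F z] is well defined on the group, sends [g G(S)] into [phi g G(S)], and
    maps the [g_i] to elements of length at most [n^2 M^2]. Cosets that meet still
    meet. Cosets that do not meet are kept apart because the chains survive: the
    image of [w] is distinguished from [G(St a) G(St b)] in an iterated wreath
    product of copies of Z, one for each letter of the chain. *)
From Stdlib Require Import Relation_Operators Setoid Morphisms.
Require Import Defs.
From mathcomp Require Import all_boot ssralg ssrint boolp.
Set Implicit Arguments. Unset Strict Implicit. Unset Printing Implicit Defensive.

(** * Maxima and flattened sequences *)

Lemma bigmax_attained (I : eqType) (r : seq I) (P : pred I) (f : I -> nat) :
  0 < \max_(i <- r | P i) f i ->
  exists i, [/\ i \in r, P i & f i = \max_(i <- r | P i) f i].
Proof.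
elim: r => [|i r IH]; rewrite ?big_nil // big_cons.
case: (boolP (P i)) => [Pi|_]; last first.
  by case/IH=> j [jr Pj fj]; exists j; rewrite inE jr orbT.
case: (leqP (\max_(j <- r | P j) f j) (f i)) => [_ _|lt _].
  by exists i; rewrite inE eqxx.
have [j [jr Pj fj]] := IH (leq_ltn_trans (leq0n _) lt).
by exists j; rewrite inE jr orbT.
Qed.

Lemma size_flatten_leq (I : eqType) (A : Type) (f : I -> seq A) m s :
  (forall i, size (f i) <= m) -> size (flatten [seq f i | i <- s]) <= size s * m.
Proof.
move=> fm; elim: s => //= i s IH.
by rewrite size_cat mulSn leq_add.
Qed.

(** * Words and equality in the group *)

Section NormalForm.
Variables (T : finType) (e : rel T).
Hypotheses (e_sym : symmetric e) (e_irr : irreflexive e).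

Local Notation letter := (letter T).
Local Notation word := (word T).
Local Notation weq := (weq e).

Definition linv (l : letter) : letter := (l.1, ~~ l.2).

Lemma linvK : involutive linv.
Proof. by case=> x b; rewrite /linv /= negbK. Qed.

Lemma inv_word_cons l (w : word) : inv_word (l :: w) = rcons (inv_word w) (linv l).
Proof. by rewrite /inv_word /= rev_cons. Qed.

Lemma inv_word_cat (u v : word) : inv_word (u ++ v) = inv_word v ++ inv_word u.
Proof. by rewrite /inv_word map_cat rev_cat. Qed.

Lemma inv_wordK : involutive (@inv_word T).
Proof.
move=> w; rewrite /inv_word map_rev revK -map_comp map_id_in // => l _.
exact: linvK.
Qed.

Lemma mem_inv_word l (w : word) : (l \in inv_word w) = (linv l \in w).
Proof.
rewrite /inv_word mem_rev -{1}[l]linvK mem_map //.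
exact: (inv_inj linvK).
Qed.

Lemma all_inv_word (P : pred T) (w : word) :
  all (fun l => P l.1) (inv_word w) = all (fun l => P l.1) w.
Proof. by rewrite /inv_word all_rev all_map; apply: eq_all. Qed.

Global Instance weq_equivalence : Equivalence weq.
Proof.
split; first by move=> x; apply: rst_refl.
- by move=> x y; apply: rst_sym.
by move=> x y z; apply: rst_trans.
Qed.

Lemma weq_refl w : weq w w. Proof. exact: rst_refl. Qed.
#[local] Hint Resolve weq_refl : core.

Lemma weq_ctx s t u v : weq u v -> weq (s ++ u ++ t) (s ++ v ++ t).
Proof.
elim=> {u v} [_ _ [u w x b|u w x y b c exy] | u | u v _ IH | u v w _ IH1 _ IH2].
- have := rst_step _ _ _ _ (step_cancel e (s ++ u) (w ++ t) x b).
  by rewrite -!catA.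
- have := rst_step _ _ _ _ (step_comm (s ++ u) (w ++ t) b c exy).
  by rewrite -!catA.
- by [].
- by symmetry.
- by rewrite IH1.
Qed.

Global Instance weq_cat : Proper (weq ==> weq ==> weq) (@cat letter).
Proof.
move=> u u' uu' v v' vv'; transitivity (u' ++ v).
  exact: (weq_ctx [::] v uu').
by have := weq_ctx u' [::] vv'; rewrite !cats0.
Qed.

Lemma weq_cancel l : weq [:: l; linv l] [::].
Proof.
by case: l => x b; apply: rst_step (step_cancel e [::] [::] x b).
Qed.

Lemma weq_cancelV l : weq [:: linv l; l] [::].
Proof. by have := weq_cancel (linv l); rewrite linvK. Qed.

Lemma weq_swap l m : e l.1 m.1 -> weq [:: l; m] [:: m; l].
Proof.
case: l m => x b [y c] /= exy.
by apply: rst_step (step_comm [::] [::] b c exy).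
Qed.

Lemma weq_mulV w : weq (w ++ inv_word w) [::].
Proof.
elim: w => [|l w IH] //=; rewrite inv_word_cons -cats1.
change (weq ([:: l] ++ w ++ inv_word w ++ [:: linv l]) [::]).
by rewrite (catA w) IH; apply: weq_cancel.
Qed.

Lemma weq_mulVr w : weq (inv_word w ++ w) [::].
Proof. by have := weq_mulV (inv_word w); rewrite inv_wordK. Qed.

Global Instance weq_inv_word : Proper (weq ==> weq) (@inv_word T).
Proof.
move=> u v uv; transitivity (inv_word u ++ v ++ inv_word v).
  by rewrite weq_mulV cats0.
rewrite catA; transitivity ((inv_word u ++ u) ++ inv_word v).
  by apply: weq_cat => //; apply: weq_cat => //; symmetry.
by rewrite weq_mulVr.
Qed.

Lemma weq_comm_words u v :
  all (fun l => all (fun m => e l.1 m.1) v) u -> weq (u ++ v) (v ++ u).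
Proof.
elim: u => [|l u IH] /=; first by rewrite cats0.
case/andP=> lv /IH uv; transitivity ([:: l] ++ v ++ u); first by rewrite -uv.
rewrite catA -[v ++ l :: u]cat_rcons -cats1; apply: weq_cat => //.
elim: v lv {IH uv} => //= m v IH /andP[lm /IH {}IH].
transitivity ([:: m] ++ [:: l] ++ v).
  by have := weq_ctx [::] v (weq_swap lm).
by have := weq_ctx [:: m] [::] IH; rewrite !cats0.
Qed.

(* Equality in the trace monoid: commutations only, no cancellation. *)
Definition cstep (u v : word) : Prop :=
  exists s t l m, [/\ e l.1 m.1, u = s ++ l :: m :: t & v = s ++ m :: l :: t].
Definition ceq : word -> word -> Prop := clos_refl_sym_trans word cstep.

Global Instance ceq_equivalence : Equivalence ceq.
Proof.
split; first by move=> x; apply: rst_refl.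
- by move=> x y; apply: rst_sym.
by move=> x y z; apply: rst_trans.
Qed.

Lemma ceq_refl w : ceq w w. Proof. exact: rst_refl. Qed.
#[local] Hint Resolve ceq_refl : core.

Lemma ceq_swap l m t : e l.1 m.1 -> ceq (l :: m :: t) (m :: l :: t).
Proof. by move=> lm; apply: rst_step; exists [::], t, l, m. Qed.

Global Instance ceq_cons l : Proper (ceq ==> ceq) (cons l).
Proof.
move=> u v; elim=> {u v} [u v [s [t [k [m [km -> ->]]]]] | u | u v _ IH | u v w _ IH1 _ IH2].
- by apply: rst_step; exists (l :: s), t, k, m.
- by [].
- by symmetry.
- by rewrite IH1.
Qed.

Lemma ceq_ctxl s u v : ceq u v -> ceq (s ++ u) (s ++ v).
Proof. by move=> uv; elim: s => //= l s ->. Qed.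

Lemma ceq_comm_letter l v :
  all (fun m => e l.1 m.1) v -> ceq (l :: v) (rcons v l).
Proof.
elim: v => //= m v IH /andP[lm /IH <-]; exact: ceq_swap.
Qed.

Lemma ceq_weq u v : ceq u v -> weq u v.
Proof.
elim=> {u v} [u v [s [t [l [m [lm -> ->]]]]] | u | u v _ IH | u v w _ IH1 _ IH2].
- by have := weq_ctx s t (weq_swap lm).
- by [].
- by symmetry.
- by rewrite IH1.
Qed.

Lemma ceq_perm u v : ceq u v -> perm_eq u v.
Proof.
elim=> {u v} [u v [s [t [l [m [lm -> ->]]]]] | u | u v _ IH | u v w _ IH1 _ IH2].
- by rewrite perm_cat2l; apply/permEl/(perm_catCA [:: l] [:: m]).
- by [].
- by rewrite perm_sym.
- exact: perm_trans IH1 IH2.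
Qed.

(** * Cancellation and normal forms *)

Fixpoint del (l : letter) (w : word) : option word :=
  if w is m :: w' then
    if m == linv l then Some w'
    else if e l.1 m.1 then omap (cons m) (del l w') else None
  else None.

(** Van der Waerden's method: letters act on reduced words modulo [ceq], and [nf] is the image of
    the empty word. [lpush_lpushV] and [lpushC] verify the defining relations for this action. *)
Definition lpush l w := if del l w is Some w' then w' else l :: w.

Definition nf (w : word) : word := foldr lpush [::] w.

Fixpoint reduced (w : word) : bool :=
  if w is l :: w' then ~~ isSome (del l w') && reduced w' else true.

Definition oceq (u v : option word) : Prop :=
  match u, v with
  | Some u, Some v => ceq u v
  | None, None => True
  | _, _ => False
  end.

Lemma neq_adj l m : e l.1 m.1 -> (m == linv l) = false.
Proof.
move=> lm; apply/negP => /eqP ml; move: lm.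
by rewrite ml /= e_irr.
Qed.

Lemma del_swap l m k t : e m.1 k.1 ->
  oceq (del l (m :: k :: t)) (del l (k :: m :: t)).
Proof.
move=> mk /=; have km : e k.1 m.1 by rewrite e_sym.
have [ml|ml] := eqVneq m (linv l).
  have lk : e l.1 k.1 by move: mk; rewrite ml.
  by rewrite neq_adj // lk /=; apply: rst_refl.
have [kl|kl] := eqVneq k (linv l).
  have lm : e l.1 m.1 by move: km; rewrite kl.
  by rewrite lm /=; apply: rst_refl.
case: (e l.1 m.1); case: (e l.1 k.1) => //=.
by case: (del l t) => //= w; apply: ceq_swap.
Qed.

Lemma del_ceq l u v : ceq u v -> oceq (del l u) (del l v).
Proof.
elim=> {u v} [u v [s [t [k [m [km -> ->]]]]] | u | u v _ IH | u v w _ IH1 _ IH2].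
- elim: s => [|n s IH]; first exact: del_swap.
  rewrite !cat_cons /=; case: eqP => _.
    by apply: rst_step; exists s, t, k, m.
  case: (e l.1 n.1) => //.
  by case: (del l _) IH => [x|]; case: (del l _) => [y|] //= ->.
- by case: (del l u) => //= w; apply: rst_refl.
- by case: (del l u) IH => [x|]; case: (del l v) => [y|] //=; symmetry.
- case: (del l u) IH1 => [x|]; case: (del l v) IH2 => [y|];
    case: (del l w) => [z|] //= yz xy.
  by transitivity y.
Qed.

Lemma isSome_del_ceq l u v : ceq u v -> isSome (del l u) = isSome (del l v).
Proof. by move/(del_ceq l); case: (del l u); case: (del l v). Qed.

Lemma del_some_ceq l w w' : del l w = Some w' -> ceq w (linv l :: w').
Proof.
elim: w w' => //= m w IH w'; case: eqP => [-> [->]|_]; first by [].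
case: ifP => // lm; case: (del l w) IH => //= x IH [<-].
by rewrite (IH x) //; apply: ceq_swap; rewrite /= e_sym.
Qed.

Lemma del_decomp l w w' : del l w = Some w' ->
  exists v t, [/\ w = v ++ linv l :: t, w' = v ++ t & all (fun m => e l.1 m.1) v].
Proof.
elim: w w' => //= m w IH w'; case: eqP => [-> [<-]|_]; first by exists [::], w.
case: ifP => // lm; case: (del l w) IH => //= x /(_ x erefl)[v [t [-> -> vl]]] [<-].
by exists (m :: v), t; rewrite /= lm.
Qed.

Lemma del_cat_linv l v t : all (fun m => e l.1 m.1) v ->
  isSome (del l (v ++ linv l :: t)).
Proof.
elim: v => /= [|m v IH]; first by rewrite eqxx.
by case/andP=> -> /IH; case: eqP => //; case: (del _ _).
Qed.

Lemma del_reduced l w w' : reduced w -> del l w = Some w' -> reduced w'.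
Proof.
elim: w w' => //= m w IH w' /andP[mw wr]; case: eqP => [_ [<-] //|_].
case: ifP => // lm; case E: (del l w) => [x|] //= [<-] /=.
rewrite (IH x) // andbT; move: mw.
rewrite (isSome_del_ceq m (del_some_ceq E)) /=.
rewrite [_ == _]neq_adj; last by rewrite /= e_sym.
by rewrite e_sym lm; case: (del m x).
Qed.

Lemma lpush_reduced l w : reduced w -> reduced (lpush l w).
Proof.
rewrite /lpush; case E: (del l w) => [x|] wr; first exact: del_reduced E.
by rewrite /= E.
Qed.

Lemma nf_reduced w : reduced (nf w).
Proof. by elim: w => //= l w IH; apply: lpush_reduced. Qed.

Lemma lpush_weq l w : weq (lpush l w) (l :: w).
Proof.
rewrite /lpush; case E: (del l w) => [x|] //.
rewrite (ceq_weq (ceq_cons l (del_some_ceq E))).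
by have := weq_ctx [::] x (weq_cancel l) => /= ->.
Qed.

Lemma nf_weq w : weq (nf w) w.
Proof.
elim: w => //= l w IH; rewrite lpush_weq.
by change (weq ([:: l] ++ nf w) ([:: l] ++ w)); rewrite IH.
Qed.

Lemma reduced_nf w : reduced w -> nf w = w.
Proof.
elim: w => //= l w IH /andP[lw /IH->]; rewrite /lpush.
by case: (del l w) lw.
Qed.

Global Instance lpush_ceq l : Proper (ceq ==> ceq) (lpush l).
Proof.
move=> u v uv; rewrite /lpush; have := del_ceq l uv.
by case: (del l u); case: (del l v) => //= _; rewrite uv.
Qed.

Lemma reduced_ceq u v : ceq u v -> reduced u = reduced v.
Proof.
elim=> {u v} [u v [s [t [l [m [lm -> ->]]]]] | u | u v _ -> | u v w _ -> _ ->] //.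
elim: s => [|n s IH]; last first.
  rewrite !cat_cons /= IH; congr (~~ _ && _); apply: isSome_del_ceq.
  by apply: rst_step; exists s, t, l, m.
have ml : e m.1 l.1 by rewrite e_sym.
rewrite /= !neq_adj // lm ml.
by case: (del l t); case: (del m t).
Qed.

Lemma lpush_lpushV l w : reduced w -> ceq (lpush l (lpush (linv l) w)) w.
Proof.
move=> wr; rewrite {2}/lpush; case E: (del (linv l) w) => [x|]; last first.
  by rewrite /lpush /= eqxx.
have := del_some_ceq E; rewrite linvK => wx.
move: wr; rewrite (reduced_ceq wx) /= /lpush => /andP[lx _].
by case: (del l x) lx => // _; symmetry.
Qed.

Lemma ceq_cancel l u v : ceq (l :: u) (l :: v) -> ceq u v.
Proof. by move/(del_ceq (linv l)); rewrite /= linvK eqxx. Qed.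

Lemma lpushC l m w : e l.1 m.1 ->
  ceq (lpush l (lpush m w)) (lpush m (lpush l w)).
Proof.
move=> lm; have ml : e m.1 l.1 by rewrite e_sym.
have lmN : (linv m == linv l) = false by rewrite neq_adj.
have mlN : (linv l == linv m) = false by rewrite neq_adj.
have ml' : (m == linv l) = false by rewrite neq_adj.
have lm' : (l == linv m) = false by rewrite neq_adj.
rewrite {2 4}/lpush; case El: (del l w) => [x|]; case Em: (del m w) => [y|].
- have := del_ceq l (del_some_ceq Em); have := del_ceq m (del_some_ceq El).
  rewrite El Em /= lmN mlN lm ml /lpush.
  case Ey: (del l y) => [y'|] //=; case Ex: (del m x) => [x'|] //= yx xy.
  have yy := del_some_ceq Ey.
  by apply: (@ceq_cancel (linv l)); rewrite -yx -yy.
- have := del_ceq m (del_some_ceq El).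
  rewrite Em /= mlN ml /lpush /= ml' lm El /=.
  by case: (del m x).
- have := del_ceq l (del_some_ceq Em).
  rewrite El /= lmN lm /lpush /= lm' ml Em /=.
  by case: (del l y).
- by rewrite /lpush /= ml' lm' lm ml El Em /=; apply: ceq_swap.
Qed.

Lemma nf_cat u v : nf (u ++ v) = foldr lpush (nf v) u.
Proof. exact: foldr_cat. Qed.

Lemma foldr_lpush_ceq s u v : ceq u v -> ceq (foldr lpush u s) (foldr lpush v s).
Proof. by move=> uv; elim: s => //= l s ->. Qed.

Lemma weq_nf u v : weq u v -> ceq (nf u) (nf v).
Proof.
elim=> {u v} [_ _ [u w x b|u w x y b c exy] | u | u v _ IH | u v w _ IH1 _ IH2].
- rewrite !nf_cat; apply: foldr_lpush_ceq => /=.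
  by have := lpush_lpushV (x, b) (nf_reduced w).
- by rewrite !nf_cat; apply: foldr_lpush_ceq => /=; apply: lpushC.
- by [].
- by symmetry.
- by rewrite IH1.
Qed.

Lemma weq_reduced u v : reduced u -> reduced v -> weq u v -> ceq u v.
Proof. by move=> /reduced_nf {2}<- /reduced_nf {2}<-; apply: weq_nf. Qed.

Lemma mem_lpush l w : {subset lpush l w <= l :: w}.
Proof.
move=> k; rewrite /lpush; case E: (del l w) => [x|] // kx.
have [v [t [-> xE _]]] := del_decomp E; move: kx; rewrite xE.
by rewrite !(inE, mem_cat) => /orP[] ->; rewrite !orbT.
Qed.

Lemma mem_nf w : {subset nf w <= w}.
Proof.
elim: w => //= l w IH k /mem_lpush; rewrite !inE => /orP[-> //|/IH->].
exact: orbT.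
Qed.

(** [nf] only deletes letters, and [ceq] only permutes them. *)
Lemma reduced_support (P : pred letter) w v :
  reduced w -> weq w v -> all P v -> all P w.
Proof.
move=> wr wv /allP Pv; have := ceq_perm (weq_nf wv); rewrite reduced_nf //.
by move=> /perm_all->; apply/allP => k /mem_nf; apply: Pv.
Qed.

Lemma del_cat_none l u v : ~~ isSome (del l u) -> isSome (del l (u ++ v)) ->
  all (fun m => e l.1 m.1) u /\ isSome (del l v).
Proof.
elim: u => //= m u IH; case: eqP => // _; case: ifP => //= lm.
by case: (del l u) IH => //; case: (del l (u ++ v)) => // x IH _ _; apply: IH.
Qed.

Lemma isSome_del_cat l u v : isSome (del l u) -> isSome (del l (u ++ v)).
Proof.
elim: u => //= m u IH; case: eqP => // _; case: ifP => //= lm.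
by case: (del l u) IH => //; case: (del l (u ++ v)) => // IH; move: (IH isT).
Qed.

Lemma reduced_catl u v : reduced (u ++ v) -> reduced u.
Proof.
elim: u => //= l u IH /andP[luv /IH->]; rewrite andbT.
by apply: contra luv; apply: isSome_del_cat.
Qed.

Lemma reduced_catr u v : reduced (u ++ v) -> reduced v.
Proof. by elim: u => //= l u IH /andP[_ /IH]. Qed.

Lemma not_reduced_decomp w : ~~ reduced w ->
  exists u l v t, w = u ++ l :: v ++ linv l :: t /\ all (fun m => e l.1 m.1) v.
Proof.
elim: w => //= l w IH; rewrite negb_and negbK; case E: (del l w) => [x|] /=.
  have [v [t [-> _ vl]]] := del_decomp E.
  by exists [::], l, v, t.
by case/IH => u [m [v [t [-> vm]]]]; exists (l :: u), m, v, t.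
Qed.

Lemma reducedN u l v t : all (fun m => e l.1 m.1) v ->
  ~~ reduced (u ++ l :: v ++ linv l :: t).
Proof.
move=> vl; apply/negP => /reduced_catr /= /andP[/negP[]].
by rewrite del_cat_linv.
Qed.

Lemma not_reduced_rcons w y : reduced w -> ~~ reduced (rcons w y) ->
  exists u v, w = u ++ linv y :: v /\ all (fun m => e y.1 m.1) v.
Proof.
elim: w => [|l w IH] //= /andP[lw wr]; rewrite negb_and negbK.
case: (boolP (reduced (rcons w y))) => [_|/(IH wr)[u [v [-> vy]]] _]; last first.
  by exists (l :: u), v.
rewrite orbF -cats1 => /(del_cat_none lw)[lw' /=].
case: eqP => [-> _|//]; last by case: ifP.
by exists [::], w; rewrite linvK.
Qed.

Lemma reduced_inv_word w : reduced w -> reduced (inv_word w).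
Proof.
move=> wr; apply/negPn/negP => /not_reduced_decomp[u [l [v [t [E vl]]]]].
move: wr; rewrite -[w]inv_wordK E inv_word_cat inv_word_cons inv_word_cat.
rewrite inv_word_cons linvK -!cats1 -!catA; apply/negP.
by apply: reducedN; rewrite (all_inv_word (e l.1)).
Qed.

(** * Half-spaces and hyperplanes of the Cayley graph *)

(** As a set of group elements this is a half-space: the side containing [l] of the hyperplane dual
    to the edge from 1 to [l]. *)
Definition starts l w := isSome (del (linv l) (nf w)).

Global Instance starts_weq l : Proper (weq ==> eq) (starts l).
Proof. by move=> u v /weq_nf; apply: isSome_del_ceq. Qed.

Lemma starts_reduced l w : reduced w -> starts l w = isSome (del (linv l) w).
Proof. by move=> wr; rewrite /starts reduced_nf. Qed.

Lemma startsE l x : starts l x -> exists2 r, reduced (l :: r) & weq x (l :: r).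
Proof.
rewrite /starts; case E: (del _ _) => [r|] // _.
have := del_some_ceq E; rewrite linvK => xr; exists r.
  by rewrite -(reduced_ceq xr) nf_reduced.
by rewrite -(ceq_weq xr) nf_weq.
Qed.

Lemma starts_head l r : reduced (l :: r) -> starts l (l :: r).
Proof. by move=> lr; rewrite starts_reduced //= linvK eqxx. Qed.

Lemma weq_canl u v w : weq (u ++ v) w -> weq v (inv_word u ++ w).
Proof. by move <-; rewrite catA weq_mulVr. Qed.

Lemma weq_canr u v w : weq (u ++ v) w -> weq u (w ++ inv_word v).
Proof. by move <-; rewrite -catA weq_mulV cats0. Qed.

Lemma weq_ctxl s u v : weq u v -> weq (s ++ u) (s ++ v).
Proof. by move->. Qed.

Lemma weq_ctxr s u v : weq u v -> weq (u ++ s) (v ++ s).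
Proof. by move->. Qed.

(** Write [x] as a reduced word [l :: r]. If [y] cancels nothing, or a letter of [r], a reduced word
    beginning with [l] remains. So [y] cancels [l] itself, which commutes with all that follows
    it. *)
Lemma starts_mul_lose l x y : starts l x -> ~~ starts l (x ++ [:: y]) ->
  y = linv l /\ exists2 c, all (fun m => e l.1 m.1) c & weq x (l :: c).
Proof.
move=> /startsE[r lr xr]; rewrite (starts_weq l (weq_ctxr [:: y] xr)).
case: (boolP (reduced (rcons (l :: r) y))) => [lry|/(not_reduced_rcons lr)].
  by rewrite cats1 starts_head.
case=> -[|k u] [v /= [[kl E] vy]].
  move=> _; rewrite kl linvK; split => //; exists v => //.
  by rewrite xr kl E.
have ruv : ceq r (rcons (u ++ v) (linv y)).
  by rewrite E rcons_cat; apply/ceq_ctxl/ceq_comm_letter.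
have lruv : weq ((l :: r) ++ [:: y]) (l :: u ++ v).
  rewrite (weq_ctxr [:: y] (ceq_weq (ceq_cons l ruv))) -rcons_cons -cats1 -catA.
  by rewrite -[X in weq _ X]cats0; apply: weq_ctxl; apply: weq_cancelV.
rewrite (starts_weq l lruv) starts_head //.
move: lr; rewrite (reduced_ceq (ceq_cons l ruv)) -rcons_cons -cats1.
exact: reduced_catl.
Qed.

(** Every edge crossing the hyperplane is a translate of the edge from 1 to [l] by an element
    commuting with [l]. Gaining [l] is losing it along the reversed edge. *)
Lemma starts_cross l x y : starts l x != starts l (x ++ [:: y]) ->
  exists2 c, all (fun m => e l.1 m.1) c &
    if starts l x then y = linv l /\ weq x (l :: c) else y = l /\ weq x c.
Proof.
case: (boolP (starts l x)) => lx lxy.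
  have [||-> [c cl xc]] := @starts_mul_lose l x y; rewrite ?lx //.
  by exists c.
have xE : weq x ((x ++ [:: y]) ++ [:: linv y]).
  by rewrite -catA /= (weq_cancel y) cats0.
have lxy' : starts l (x ++ [:: y]) by case: (starts l (x ++ _)) lxy.
have [|/(inv_inj linvK) yl [c cl xc]] := @starts_mul_lose l (x ++ [:: y]) (linv y) lxy'.
  by rewrite -(starts_weq l xE).
exists c; rewrite // yl; split => //.
move: xc; rewrite yl (ceq_weq (ceq_comm_letter cl)) -cats1 => /weq_canr ->.
by rewrite -catA weq_mulV cats0.
Qed.

(** A second crossing would be by [linv y], and the subword between the crossings would equal
    [inv_word c ++ c'], so its letters would commute with [y] and the whole word would not be
    reduced. *)
Lemma starts_cross_once l x y w : reduced (y :: w) ->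
  starts l x != starts l (x ++ [:: y]) ->
  starts l (x ++ y :: w) = ~~ starts l x.
Proof.
move=> + cross; elim/last_ind: w => [_|w m IH ywr].
  by case: (starts l x) cross; case: (starts _ _).
have {}IH : starts l (x ++ y :: w) = ~~ starts l x.
  by apply: IH; move: ywr; rewrite -rcons_cons -cats1; apply: reduced_catl.
apply/eqP/negPn/negP => back.
have cross' : starts l (x ++ y :: w) != starts l ((x ++ y :: w) ++ [:: m]).
  rewrite -catA cat_cons cats1 IH.
  by case: (starts l x) back; case: (starts l (x ++ _)).
have [c cl xc] := starts_cross cross; have [c' cl' xc'] := starts_cross cross'.
have [my wE] : m = linv y /\ weq w (inv_word c ++ c').
  move: xc xc'; rewrite IH -(cat1s y w) (catA x); case: (starts l x) => /= -[-> xc] [-> xc'].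
    split; first by rewrite linvK.
    apply: weq_canl; rewrite -xc'; apply: weq_ctxr; symmetry.
    rewrite xc (ceq_weq (ceq_comm_letter cl)) -cats1 -catA.
    by rewrite -[X in weq _ X]cats0; apply: weq_ctxl; apply: weq_cancel.
  split=> //; have := weq_canl xc'; rewrite xc.
  rewrite cats1 -(ceq_weq (ceq_comm_letter cl)) inv_word_cons -cats1 -catA => ->.
  apply: weq_ctxl; exact: (weq_ctxr c' (weq_cancelV l)).
have yl : y.1 = l.1 by move: xc; case: ifP => _ [-> _].
have wl : all (fun k => e y.1 k.1) w.
  rewrite yl; apply: (@reduced_support (fun k => e l.1 k.1)) wE _.
    by move: ywr; rewrite -cat1s -cats1 => /reduced_catr/reduced_catl.
  by rewrite all_cat (all_inv_word (e l.1)) cl.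
move: ywr; rewrite my; apply/negP; rewrite -cats1.
by apply: (@reducedN [::] y w [::]).
Qed.

(** A reduced path that has crossed the hyperplane cannot come back. *)
Lemma starts_convex l x u v : reduced (u ++ v) ->
  starts l (x ++ u ++ v) = starts l x -> starts l (x ++ u) = starts l x.
Proof.
elim: u x => [|y u IH] x; first by rewrite cats0.
rewrite cat_cons => yuv E.
case: (eqVneq (starts l x) (starts l (x ++ [:: y]))) => [Ey|/(starts_cross_once yuv)].
  rewrite -cat1s catA Ey; apply: IH; first by case/andP: yuv.
  by rewrite -Ey -E -!catA.
by rewrite E; case: (starts l x).
Qed.

Lemma starts_comm_left l c x : all (fun m => e l.1 m.1) c ->
  starts l (c ++ x) = starts l x.
Proof.
elim: c => //= m c IH /andP[lm /IH <-]; rewrite /starts /= /lpush.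
case E: (del m _) => [r|] /=.
  rewrite (isSome_del_ceq (linv l) (del_some_ceq E)) /= lm linvK.
  case: eqP => [ml|_]; first by move: lm; rewrite -ml /= e_irr.
  by case: (del _ r).
rewrite linvK lm; case: eqP => [ml|_]; last by case: (del _ _).
by move: lm; rewrite -ml e_irr.
Qed.

Lemma starts_cons_self l x : starts l (l :: x) = ~~ starts (linv l) x.
Proof.
rewrite /starts linvK /= /lpush; case E: (del l (nf x)) => [r|] /=.
  have := nf_reduced x; rewrite (reduced_ceq (del_some_ceq E)) /=.
  by case/andP=> /negbTE.
by rewrite linvK eqxx.
Qed.

(* The edge from [h] to [h l] of the Cayley graph is dual to a hyperplane;
   [side (h, l)] is the indicator function of the half-space of [h l]. *)
Definition side (H : word * letter) (g : word) := starts H.2 (inv_word H.1 ++ g).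

Global Instance side_weq H : Proper (weq ==> eq) (side H).
Proof. by move=> u v uv; apply/starts_weq/weq_ctxl. Qed.

Lemma side_near H : side H H.1 = false.
Proof. by rewrite /side (starts_weq _ (weq_mulVr _)). Qed.

Lemma side_far H : side H (H.1 ++ [:: H.2]).
Proof.
rewrite /side catA (starts_weq _ (weq_ctxr _ (weq_mulVr _))) /=.
by rewrite starts_cons_self.
Qed.

Lemma side_cross H k y : side H k != side H (k ++ [:: y]) ->
  exists2 c, all (fun m => e H.2.1 m.1) c &
    if side H k then y = linv H.2 /\ weq k (H.1 ++ H.2 :: c)
    else y = H.2 /\ weq k (H.1 ++ c).
Proof.
rewrite /side catA => /starts_cross[c cl]; case: ifP => _ [-> /weq_canl];
  rewrite inv_wordK; by exists c.
Qed.

Lemma side_letter H k y : y.1 != H.2.1 -> side H (k ++ [:: y]) = side H k.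
Proof.
move=> yH; apply/esym/eqP/negPn/negP => /side_cross[c _].
by case: ifP => _ [E _]; rewrite E eqxx in yH.
Qed.

Lemma side_word H k c : all (fun m => m.1 != H.2.1) c -> side H (k ++ c) = side H k.
Proof.
elim: c k => [|m c IH] k /=; first by rewrite cats0.
by case/andP=> mH /IH {}IH; rewrite -cat1s catA IH side_letter.
Qed.

Lemma side_convex H g u v : reduced (u ++ v) ->
  side H (g ++ u ++ v) = side H g -> side H (g ++ u) = side H g.
Proof. by rewrite /side !catA -(catA _ u v); apply: starts_convex. Qed.

Lemma side_change H g w : side H (g ++ w) != side H g ->
  exists u y t, w = u ++ y :: t /\ side H (g ++ u) != side H ((g ++ u) ++ [:: y]).
Proof.
elim: w g => [|y w IH] g; first by rewrite cats0 eqxx.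
case: (eqVneq (side H g) (side H (g ++ [:: y]))) => [E|N _]; last first.
  by exists [::], y, w; rewrite cats0.
rewrite -cat1s catA E => /IH[u [k [t [-> uk]]]].
by exists (y :: u), k, t; rewrite -(cat1s y u) (catA g).
Qed.

(** The two edges are parallel, joined by a word [c] commuting with the label. Translation by [c]
    preserves the half-space; a reversed edge yields its complement, recorded by [b]. *)
Lemma side_parallel H H' : side H' H.1 != side H' (H.1 ++ [:: H.2]) ->
  exists b, forall g, side H' g = b (+) side H g.
Proof.
move/side_cross=> [c cl]; case: H H' cl => [h l] [h' l'] /= cl.
have inv_h' d : weq h (h' ++ d) -> weq (inv_word h') (d ++ inv_word h).
  move=> hE; have /weq_canl dE : weq (h' ++ d) h by symmetry.
  rewrite (weq_ctxr _ dE) -catA.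
  by rewrite weq_mulV cats0.
case: ifP => _ [E /inv_h' hE]; [exists true | exists false] => g; rewrite /side /= E /=.
  rewrite -starts_cons_self (starts_weq _ (weq_ctxr g hE)) -catA.
  rewrite (ceq_weq (ceq_comm_letter cl)) -cats1 -catA starts_comm_left //.
by rewrite (starts_weq _ (weq_ctxr g hE)) -catA starts_comm_left.
Qed.

(** Hyperplanes with the same label do not cross. Edges dual to [H] differ by letters commuting with
    the label, none of which crosses [H'], so they all lie on one side of [H']. A reduced path
    joining the two quadrants on the other side must cross [H], yet by convexity it never leaves
    that side. *)
Lemma side_quadrants H H' : H.2.1 = H'.2.1 ->
  ~ (forall b b', exists g, side H g = b /\ side H' g = b').
Proof.
move=> HH' Q.
case: (eqVneq (side H' H.1) (side H' (H.1 ++ [:: H.2]))) => [E|]; last first.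
  (* If [H'] separates the ends of the edge of [H], the hyperplanes coincide and two quadrants are
     empty. *)
  case/side_parallel=> b HE; have [g [Hg]] := Q true b.
  by rewrite HE Hg; case: b {HE}.
have near k y : side H k != side H (k ++ [:: y]) -> side H' k = side H' H.1.
  move=> /side_cross[c cl]; have cH' : all (fun m => m.1 != H'.2.1) c.
    apply: sub_all cl => m; rewrite HH'; apply: contraL => /eqP->.
    by rewrite e_irr.
  case: ifP => _ [_ kE]; rewrite (side_weq _ kE); last by rewrite side_word.
  by rewrite -cat1s catA side_word.
have [p [Hp H'p]] := Q false (~~ side H' H.1).
have [q [Hq H'q]] := Q true (~~ side H' H.1).
have pq : weq (p ++ nf (inv_word p ++ q)) q.
  by rewrite nf_weq catA weq_mulV.
have := @side_change H p (nf (inv_word p ++ q)).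
rewrite (side_weq H pq) Hp Hq => /(_ isT)[u [y [t [wE /near]]]].
have := @side_convex H' p u (y :: t).
rewrite -wE nf_reduced (side_weq H' pq) H'p H'q => /(_ isT erefl) ->.
by case: (side H' H.1).
Qed.

(** * Stars, conjugates and the extension graph *)

Definition star a (x : T) := (x == a) || e a x.

Definition meets g a h b := exists u v : word,
  [/\ all (fun l => star a l.1) u, all (fun l => star b l.1) v &
      weq (g ++ u) (h ++ v)].

Definition wconj g a : word := g ++ [:: (a, false)] ++ inv_word g.

Lemma star_commute a u : all (fun l => star a l.1) u ->
  weq ([:: (a, false)] ++ u) (u ++ [:: (a, false)]).
Proof.
elim: u => [|l u IH] //= /andP[al /IH {}IH].
transitivity ([:: l] ++ [:: (a, false)] ++ u); last by rewrite IH.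
suff al' : weq [:: (a, false); l] [:: l; (a, false)] by apply: (weq_ctxr u al').
case/orP: al => [/eqP al|al]; last exact: weq_swap.
case: l al => x [] /= ->; last by [].
by rewrite (weq_cancel (a, false)) (weq_cancel (a, true)).
Qed.

Lemma conj_star g a u : all (fun l => star a l.1) u ->
  weq (wconj (g ++ u) a) (wconj g a).
Proof.
move=> au; rewrite /wconj inv_word_cat -!catA; apply: weq_ctxl.
by rewrite (catA u) -(star_commute au) -catA (catA u) weq_mulV.
Qed.

Global Instance conj_weq : Proper (weq ==> eq ==> weq) wconj.
Proof.
move=> g h gh a _ <-; rewrite /wconj; apply: weq_cat => //.
by apply/weq_ctxl/weq_inv_word.
Qed.

Lemma conj_conj k g a :
  weq (k ++ wconj g a ++ inv_word k) (wconj (k ++ g) a).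
Proof. by rewrite /wconj inv_word_cat -!catA. Qed.

Lemma conj_mul g u v :
  weq (g ++ (u ++ v) ++ inv_word g)
      ((g ++ u ++ inv_word g) ++ (g ++ v ++ inv_word g)).
Proof.
rewrite -!catA (catA (inv_word g)).
by do 2 apply: weq_ctxl; rewrite weq_mulVr.
Qed.

Lemma generators_commute a b :
  weq [:: (a, false); (b, false)] [:: (b, false); (a, false)] -> star a b.
Proof.
rewrite /star; have [//|ba /=] := eqVneq b a.
case: (boolP (e a b)) => // ab ab_ba.
have red x y : e x y = false -> reduced [:: (x, false); (y, false)].
  by move=> xy /=; rewrite xy; case: eqP.
have ba' : e b a = false by rewrite e_sym (negbTE ab).
have := weq_reduced (red a b (negbTE ab)) (red b a ba') ab_ba.
move/(isSome_del_ceq (a, true)) => /=.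
by rewrite /linv /= eqxx xpair_eqE (negbTE ba) (negbTE ab).
Qed.

Lemma generator_inj a b : weq [:: (a, false)] [:: (b, false)] -> a = b.
Proof.
by move/weq_nf/ceq_perm/perm_mem => /(_ (a, false)); rewrite !inE eqxx => /esym/eqP[].
Qed.

Definition ends l (w : word) := starts (linv l) (inv_word w).

(** Initial letters in [star a] and final letters in [star b] are stripped from [w] as long as there
    are any, by induction on the length of the normal form. *)
Lemma double_coset_min a b w : exists u w0 v,
  [/\ all (fun l => star a l.1) u, all (fun l => star b l.1) v,
      weq w (u ++ w0 ++ v), reduced w0 &
      forall l, (star a l.1 -> ~~ starts l w0) /\ (star b l.1 -> ~~ ends l w0)].
Proof.
have [n] := ubnP (size (nf w)).
elim: n w => // n IH w; rewrite ltnS => wn.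
case: (pickP (fun l => star a l.1 && starts l w)) => [l /andP[al lw]|aw].
  have [r lr wr] := startsE lw.
  have [|u [w0 [v [au bv rE w0r w0P]]]] := IH r.
    apply: leq_trans wn; have := perm_size (ceq_perm (weq_nf wr)).
    by rewrite (reduced_nf lr) => ->; case/andP: lr => _ /reduced_nf->.
  exists (l :: u), w0, v; split=> //=; first by rewrite al.
  by rewrite wr -cat1s rE.
case: (pickP (fun l => star b l.1 && ends l w)) => [l /andP[bl lw]|bw].
  have [r lr wr] := startsE lw.
  have wE : weq w (inv_word r ++ [:: l]).
    have := weq_inv_word wr; rewrite inv_wordK inv_word_cons linvK => ->.
    by rewrite cats1.
  have rl : reduced (inv_word r ++ [:: l]).
    by have := reduced_inv_word lr; rewrite inv_word_cons linvK cats1.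
  have [|u [w0 [v [au bv rE w0r w0P]]]] := IH (inv_word r).
    apply: leq_trans wn; have := perm_size (ceq_perm (weq_nf wE)).
    rewrite (reduced_nf rl) => ->; rewrite reduced_nf ?(reduced_catl rl) //.
    by rewrite size_cat addn1.
  exists u, w0, (v ++ [:: l]); split=> //; first by rewrite all_cat bv /= bl.
  by rewrite wE rE -!catA.
exists [::], (nf w), [::]; split; rewrite ?nf_reduced //=.
  by rewrite cats0 nf_weq.
move=> l; split=> sl; first by
  rewrite (starts_weq _ (nf_weq w)); have := aw l; rewrite sl => /negbT.
rewrite /ends (starts_weq _ (weq_inv_word (nf_weq w))).
by have := bw l; rewrite sl => /negbT.
Qed.

Lemma ends_last w l v : reduced (w ++ l :: v) -> all (fun m => e l.1 m.1) v ->
  ends l (w ++ l :: v).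
Proof.
move=> /reduced_inv_word wr lv; rewrite /ends starts_reduced // linvK.
rewrite inv_word_cat inv_word_cons -cats1 -catA del_cat_linv //.
by rewrite (all_inv_word (e l.1)).
Qed.

Lemma reduced_cat p q : reduced p -> reduced q ->
  (forall l, ends l p -> ~~ starts (linv l) q) -> reduced (p ++ q).
Proof.
move=> + qr; elim: p => //= l p IH lpr pq; have /andP[lp pr] := lpr.
apply/andP; split; last first.
  apply: IH => // m mp; apply: pq; move: mp.
  rewrite /ends !starts_reduced ?reduced_inv_word //.
  by rewrite inv_word_cons -cats1; apply: isSome_del_cat.
apply/negP => /(del_cat_none lp)[lp' lq].
have /pq := @ends_last [::] l p lpr lp'.
by rewrite starts_reduced // linvK lq.
Qed.

Lemma reduced_conj w b : reduced w ->
  (forall l, star b l.1 -> ~~ ends l w) -> reduced (wconj w b).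
Proof.
move=> wr wb; apply: reduced_cat => //=.
  rewrite reduced_inv_word // andbT.
  have := wb (b, false); rewrite /star eqxx => /(_ isT).
  by rewrite /ends starts_reduced ?reduced_inv_word // linvK.
move=> l lw; rewrite starts_reduced /= ?linvK; last first.
  rewrite reduced_inv_word // andbT.
  have := wb (b, false); rewrite /star eqxx => /(_ isT).
  by rewrite /ends starts_reduced ?reduced_inv_word // linvK.
case: eqP => [[bl _]|_].
  by have := wb l; rewrite /star bl eqxx lw => /(_ isT).
case: ifP => // lb.
by have := wb l; rewrite /star e_sym lb orbT lw => /(_ isT).
Qed.

(** An initial letter [l] coming from beyond [w] commutes with all of [w]. If it is the middle [b],
    the last letter of [w] lies in [star b]. Otherwise [l] occurs in [inv_word w], so [w] contains
    its inverse, which is not adjacent to it. *)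
Lemma starts_conj l w b : reduced w -> w <> [::] ->
  (forall m, star b m.1 -> ~~ ends m w) -> starts l (wconj w b) -> starts l w.
Proof.
move=> wr w0 wb; rewrite starts_reduced ?reduced_conj // starts_reduced //.
apply: contraLR => lw; apply/negP => /(del_cat_none lw)[/= lw'].
rewrite linvK; case: eqP => [bl _|_].
  case/lastP: w wr w0 wb lw lw' => // w m wr _ wb _.
  rewrite all_rcons -bl /= => /andP[bm _].
  have := wb m; rewrite /star bm orbT => /(_ isT)/negP[].
  by rewrite -cats1 ends_last // cats1.
case: ifP => // _; case E: (del _ _) => [r|] // _.
have [v [t [wE _ _]]] := del_decomp E.
have : l \in inv_word w by rewrite wE linvK mem_cat inE eqxx orbT.
by rewrite mem_inv_word => /(allP lw'); rewrite /= e_irr.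
Qed.

Lemma conj_inj k u v :
  weq (k ++ u ++ inv_word k) (k ++ v ++ inv_word k) -> weq u v.
Proof.
move=> /weq_canl; rewrite catA weq_mulVr /= => /weq_canr.
by rewrite -catA weq_mulV cats0.
Qed.

(** Translation reduces to [a] and [Y = w b w^-1] with [w] minimal in its double coset. If [w] is
    nonempty, [Y] has no initial letter in [star a], whereas [Y a = a Y] starts with [a]. Then
    [starts_cross] makes all letters of [Y] adjacent to [a], a contradiction at its first letter. *)
Lemma conj_commute g a h b :
  weq (wconj g a ++ wconj h b) (wconj h b ++ wconj g a) ->
  meets g a h b /\ star a b.
Proof.
have [u [w [v [au bv wE wr wP]]]] := double_coset_min a b (inv_word g ++ h).
set k := g ++ u.
have hE : weq h ((k ++ w) ++ v).
  have := weq_ctxl g wE; rewrite catA weq_mulV /= => ->.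
  by rewrite /k -!catA.
have aE : weq (wconj g a) (k ++ [:: (a, false)] ++ inv_word k).
  by rewrite -(conj_star g au).
have bE : weq (wconj h b) (k ++ wconj w b ++ inv_word k).
  by rewrite conj_conj -(conj_star (k ++ w) bv); apply: conj_weq.
rewrite aE bE -!conj_mul => /conj_inj; case: (eqVneq w [::]) => [w0|/eqP w0].
  rewrite w0 => /generators_commute ab; split=> //.
  exists u, (inv_word v); split; rewrite ?(all_inv_word (star b)) //.
  by rewrite hE w0 cats0 -catA weq_mulV cats0.
move=> aYYa; exfalso; set Y := wconj w b in aYYa.
have Ystart l : star a l.1 -> starts l Y = false.
  move=> al; apply/negP => /(starts_conj wr w0 (fun m => (wP m).2)).
  exact/negP/((wP l).1 al).
have aY : starts (a, false) ([:: (a, false)] ++ Y).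
  by rewrite starts_cons_self Ystart // /star eqxx.
have Ya0 : starts (a, false) Y = false by rewrite Ystart // /star eqxx.
have [|c ac] := @starts_cross (a, false) Y (a, false).
  by rewrite -(starts_weq _ aYYa) aY Ya0.
rewrite Ya0 => -[_ Yc].
have Yr : reduced Y by apply: reduced_conj => // m; case: (wP m).
have := reduced_support Yr Yc ac.
case EY: Y Yr => [|m Y'] Yr.
  by move: EY; rewrite /Y /wconj; case: (w).
case/andP=> am _; have := Ystart m; rewrite EY starts_head //.
by rewrite /star am orbT => /(_ isT).
Qed.

Lemma meets_conj g a h b : meets g a h b ->
  exists k, weq (wconj g a) (wconj k a) /\ weq (wconj h b) (wconj k b).
Proof.
move=> [u [v [au bv uv]]]; exists (g ++ u); split.
  by rewrite conj_star.
by rewrite (conj_weq uv erefl) conj_star.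
Qed.

Lemma meets_commute g a h b : meets g a h b -> star a b ->
  weq (wconj g a ++ wconj h b) (wconj h b ++ wconj g a).
Proof.
move=> /meets_conj[k [-> ->]] ab; rewrite /wconj -!conj_mul.
apply: (weq_ctx k (inv_word k)).
by have := @star_commute a [:: (b, false)]; rewrite /= ab; apply.
Qed.

Lemma meets_conj_inj g a h b : meets g a h b -> weq (wconj g a) (wconj h b) -> a = b.
Proof. by move=> /meets_conj[k [-> ->]] /conj_inj/generator_inj. Qed.

Lemma meets_conj_eq g a h : meets g a h a -> weq (wconj g a) (wconj h a).
Proof. by move=> /meets_conj[k [-> ->]]. Qed.

Lemma ext_adj_conj g a h b :
  ext_adj e (wconj g a) (wconj h b) <-> meets g a h b /\ e a b.
Proof.
split=> [[neq /conj_commute[gh /orP[/eqP ba|//]]]|[gh ab]].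
  by case: neq; move: gh; rewrite ba => /meets_conj_eq.
split; last by apply: meets_commute; rewrite // /star ab orbT.
by move=> /(meets_conj_inj gh) abE; rewrite abE e_irr in ab.
Qed.

Lemma weq_conj g a h b : weq (wconj g a) (wconj h b) <-> meets g a h b /\ a = b.
Proof.
split=> [E|[+ ab]]; last by rewrite ab; apply: meets_conj_eq.
have [|gh _] := @conj_commute g a h b; first by rewrite E.
by split=> //; apply: meets_conj_inj E.
Qed.

(** * Chains of marked letters *)

Lemma star_sym : symmetric star.
Proof. by move=> x y; rewrite /star eq_sym e_sym. Qed.

(* [chain a hs [:: z_k; ...; z_1] h]: the marked letters [z_1, ..., z_k] occur
   in this order, each one non-commuting with its predecessor ([z_1] with [a]),
   and [h] is the last one. A marked letter is stored with the prefix before it. *)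
Inductive chain (a : T) (hs : seq (word * letter)) : seq T -> word * letter -> Prop :=
| chain_start h : h \in hs -> ~~ star a h.2.1 -> chain a hs [:: h.2.1] h
| chain_step z zs h h' : chain a hs (z :: zs) h -> h' \in hs ->
    prefix (rcons h.1 h.2) h'.1 -> ~~ star z h'.2.1 ->
    chain a hs (h'.2.1 :: z :: zs) h'.

Lemma sub_chain a hs hs' zs h : {subset hs <= hs'} -> chain a hs zs h -> chain a hs' zs h.
Proof.
move=> sub; elim=> {zs h} [h hh ah | z zs h h' _ IH hh' pre zh'].
  by apply: chain_start => //; apply: sub.
by apply: chain_step IH _ pre zh'; apply: sub.
Qed.

Lemma chain_head a hs zs h : chain a hs zs h -> zs = h.2.1 :: behead zs.
Proof. by case. Qed.

Lemma chain_mem a hs zs h : chain a hs zs h -> h \in hs.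
Proof. by case. Qed.

Lemma chain_sorted a hs zs h : chain a hs zs h -> sorted (fun x y => ~~ star x y) zs.
Proof. by elim=> //= {zs h} z zs h h' _ -> _ _; rewrite star_sym => ->. Qed.

Lemma prefix_rconsW (u w : word) l : prefix u w -> prefix u (rcons w l).
Proof. by move=> uw; apply: prefix_trans uw (prefix_rcons _ _). Qed.

(** Read [w] from left to right. A letter with a marked label joins [v]; a new label outside
    [star a] starts a chain; one not commuting with some marked letter extends a chain of that
    letter; any other letter commutes with [v] and joins [u]. *)
Lemma mark_chains a w : exists (hs : seq (word * letter)) u v,
  [/\ weq w (u ++ v), all (fun l => star a l.1) u,
      all (fun l => l.1 \in [seq h.2.1 | h <- hs]) v,
      uniq [seq h.2.1 | h <- hs] &
      forall h, h \in hs -> prefix (rcons h.1 h.2) w /\ exists zs, chain a hs zs h].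
Proof.
elim/last_ind: w => [|w l [hs [u [v [wE au hv uh hsP]]]]].
  by exists [::], [::], [::].
have wlE : weq (rcons w l) (u ++ rcons v l) by rewrite -!cats1 wE -catA.
case: (boolP (l.1 \in [seq h.2.1 | h <- hs])) => lhs.
  exists hs, u, (rcons v l); split=> //; first by rewrite all_rcons lhs.
  by move=> h /hsP[pre ch]; split=> //; apply: prefix_rconsW.
have new : (exists zs, chain a ((w, l) :: hs) zs (w, l)) -> exists hs u v,
    [/\ weq (rcons w l) (u ++ v), all (fun l => star a l.1) u,
      all (fun l => l.1 \in [seq h.2.1 | h <- hs]) v,
      uniq [seq h.2.1 | h <- hs] &
      forall h, h \in hs ->
        prefix (rcons h.1 h.2) (rcons w l) /\ exists zs, chain a hs zs h].
  move=> wl; exists ((w, l) :: hs), u, (rcons v l); split=> //.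
  - rewrite all_rcons /= inE eqxx /=; apply: sub_all hv => m.
    by rewrite inE => ->; rewrite orbT.
  - by rewrite /= lhs.
  move=> h; rewrite inE => /orP[/eqP->|/hsP[pre [zs ch]]].
    by rewrite prefix_refl.
  split; first exact: prefix_rconsW.
  exists zs; apply: sub_chain ch => k kh; by rewrite inE kh orbT.
case: (boolP (star a l.1)) => [al|al]; last first.
  by apply: new; exists [:: l.1]; apply: (@chain_start _ _ (w, l)); rewrite ?inE ?eqxx.
case: (boolP (has (fun h => ~~ e h.2.1 l.1) hs)) => [/hasP[h hh hl]|].
  have [pre [zs ch]] := hsP h hh; apply: new.
  exists (l.1 :: h.2.1 :: behead zs); apply: (@chain_step _ _ _ _ h (w, l)) => //.
  - rewrite -(chain_head ch); apply: sub_chain ch => k kh; by rewrite inE kh orbT.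
  - by rewrite inE eqxx.
  rewrite /star negb_or hl andbT; apply: contra lhs => /eqP->.
  by apply: map_f.
move/hasPn=> hl; exists hs, (rcons u l), v; split=> //.
- rewrite wlE -!cats1 -catA; apply: weq_ctxl; symmetry.
  have := @weq_comm_words [:: l] v; rewrite /= andbT; apply.
  apply/allP => m /(allP hv)/mapP[h hh ->]; have := hl h hh.
  by rewrite negbK e_sym.
- by rewrite all_rcons al.
by move=> h /hsP[pre ch]; split=> //; apply: prefix_rconsW.
Qed.

Definition chained a b (hs : seq (word * letter)) :=
  exists zs h, chain a hs zs h /\ ~~ star b h.2.1.

(** Either all marked labels lie in [star b], and then so do the letters of [v], or some chain ends
    outside [star b]. Marks have distinct labels, hence the bound. *)
Lemma split_or_chained a b w :
  (exists u v, [/\ all (fun l => star a l.1) u, all (fun l => star b l.1) v &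
                   weq w (u ++ v)]) \/
  exists hs : seq (word * letter),
    [/\ size hs <= #|T|, forall h, h \in hs -> prefix (rcons h.1 h.2) w &
        chained a b hs].
Proof.
have [hs [u [v [wE au hv uh hsP]]]] := mark_chains a w.
case: (boolP (all (fun h => star b h.2.1) hs)) => [/allP hb|/allPn[h hh hb]].
  left; exists u, v; split=> //; apply/allP => m /(allP hv)/mapP[h hh ->].
  exact: hb.
right; exists hs; split.
- by rewrite -(size_map (fun h : word * letter => h.2.1)) -(card_uniqP uh) max_card.
- by move=> k /hsP[].
by have [_ [zs ch]] := hsP h hh; exists zs, h.
Qed.

(** * Invariants in iterated wreath products *)

Local Open Scope ring_scope.
Import GRing.Theory.

(* Signed number of occurrences of [z] in [y] at those moments when the word
   read so far, starting from [x], satisfies [P]. *)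
Fixpoint acc (z : T) (P : pred word) (x y : word) : int :=
  if y is l :: y' then
    (if (l.1 == z) && P x then (-1) ^+ l.2 else 0) + acc z P (rcons x l) y'
  else 0.

(* The coordinates of an iterated wreath product of copies of Z: the state of
   level [z :: zs] counts the exponent of [z] separately for each state of
   level [zs]. [eqst zs x y] says that [x] and [y] lead to the same state. *)
Fixpoint eqst (zs : seq T) (x y : word) : bool :=
  if zs is z :: zs' then
    `[< forall s, acc z (eqst zs' s) [::] x = acc z (eqst zs' s) [::] y >]
  else true.

Lemma eqstP z zs x y :
  reflect (forall s, acc z (eqst zs s) [::] x = acc z (eqst zs s) [::] y)
          (eqst (z :: zs) x y).
Proof. exact: asboolP. Qed.

Lemma eqst_refl zs x : eqst zs x x.
Proof. by case: zs => // z zs; apply/eqstP. Qed.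

Lemma eqst_sym zs x y : eqst zs x y = eqst zs y x.
Proof. by case: zs => // z zs; apply/eqstP/eqstP => + s => ->. Qed.

Lemma eqst_trans zs : transitive (eqst zs).
Proof.
by case: zs => // z zs y x t /eqstP xy /eqstP yt; apply/eqstP => s; rewrite xy.
Qed.

Lemma eqst_eqr zs s x y : eqst zs x y -> eqst zs s x = eqst zs s y.
Proof.
move=> xy; apply/idP/idP => sx; first exact: eqst_trans xy.
by apply: eqst_trans sx _; rewrite eqst_sym.
Qed.

Lemma acc_cat z P x y y' : acc z P x (y ++ y') = acc z P x y + acc z P (x ++ y) y'.
Proof.
elim: y x => [|l y IH] x /=; first by rewrite add0r cats0.
by rewrite IH addrA cat_rcons.
Qed.

Lemma acc_eq z P x x' y :
  (forall t, P (x ++ t) = P (x' ++ t)) -> acc z P x y = acc z P x' y.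
Proof.
elim: y x x' => [|l y IH] x x' xx' //=; rewrite (IH _ (rcons x' l)).
  by have := xx' [::]; rewrite !cats0 => ->.
by move=> t; rewrite !cat_rcons.
Qed.

Lemma acc_off z P x y : all (fun l => l.1 != z) y -> acc z P x y = 0.
Proof.
by elim: y x => //= l y IH x /andP[/negbTE-> /IH->]; rewrite add0r.
Qed.

Lemma acc_never z P x y :
  (forall t, prefix t y -> ~~ P (x ++ t)) -> acc z P x y = 0.
Proof.
elim: y x => //= l y IH x PN; rewrite IH.
  by have := PN [::] isT; rewrite cats0 => /negbTE->; rewrite andbF addr0.
by move=> t ty; rewrite cat_rcons; apply: PN; rewrite /= eqxx.
Qed.

Definition off (zs : seq T) (c : word) :=
  if zs is z :: _ then all (fun l => l.1 != z) c else true.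

Lemma eqst_off zs x c : off zs c -> eqst zs (x ++ c) x.
Proof.
case: zs => //= z zs zc; apply/eqstP => s.
by rewrite acc_cat (acc_off _ _ zc) addr0.
Qed.

(** Consecutive entries of [zs] do not commute, so letters in [star z] never affect the counter just
    below [z]. Hence commuting a letter past [z], or cancelling [z] with its inverse, does not alter
    the lower state at which [z] is counted. *)
Lemma eqst_weq zs x y : sorted (fun x y => ~~ star x y) zs -> weq x y -> eqst zs x y.
Proof.
elim: zs x y => // z zs IHzs x y zzs.
have zzs' : sorted (fun x y => ~~ star x y) zs by case: zs zzs {IHzs} => //= ? ? /andP[].
have {}IHzs x' y' s : weq x' y' -> eqst zs s x' = eqst zs s y'.
  by move=> xy; apply/eqst_eqr/IHzs.
have off_star m : star z m.1 -> off zs [:: m].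
  case: (zs) zzs => //= k ? /andP[zk _] zm; rewrite andbT.
  by apply: contraL zk => /eqP <-; rewrite negbK.
elim=> {x y} [_ _ [u w k b|u w k m b c km] | u | u v _ IH | u v w _ IH1 _ IH2].
- apply/eqstP => s; rewrite !acc_cat /=.
  rewrite (@acc_eq _ _ (u ++ [:: (k, b); (k, ~~ b)]) u); last first.
    move=> t; apply: IHzs; rewrite -catA; apply: weq_ctxl.
    exact: (weq_ctxr t (weq_cancel (k, b))).
  congr (_ + _); have [kz|_] := eqVneq k z; last by rewrite !add0r.
  rewrite -cats1 (@eqst_eqr _ _ (u ++ _) u) /=; last first.
    by apply: eqst_off; apply: off_star; rewrite /= kz /star eqxx.
  case: (eqst zs s u); last by rewrite !add0r.
  by case: b; rewrite /= expr0 expr1 addr0 ?(addrN, addNr) ?add0r // addrA addNr add0r.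
- apply/eqstP => s; rewrite !acc_cat /=.
  rewrite (@acc_eq _ _ (u ++ [:: (k, b); (m, c)]) (u ++ [:: (m, c); (k, b)])); last first.
    move=> t; apply: IHzs; rewrite -!catA; apply: weq_ctxl.
    by apply: (weq_ctxr t (@weq_swap (k, b) (m, c) _)).
  congr (_ + (_ + _)); rewrite -!cats1 !addr0.
  have [kz|kz] := eqVneq k z.
    have [mz|_] := eqVneq m z; first by rewrite kz mz e_irr in km.
    rewrite addr0 add0r /= (@eqst_eqr _ _ (u ++ _) u) //.
    by apply: eqst_off; apply: off_star; rewrite /= -kz /star km orbT.
  have [mz|_] := eqVneq m z => //=.
  rewrite addr0 add0r (@eqst_eqr _ _ (u ++ _) u) //.
  by apply: eqst_off; apply: off_star; rewrite /= -mz /star e_sym km orbT.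
- exact: eqst_refl.
- by rewrite eqst_sym.
- exact: eqst_trans IH1 IH2.
Qed.

(** The indices satisfying [P] form an interval containing [r], so the sum telescopes; [j] is one
    more than the largest of them. *)
Lemma convex_telescope (d : nat -> int) (P : pred nat) s u r :
  (s <= r < u)%N -> P r ->
  (forall i j k, (s <= i)%N -> (i <= j <= k)%N -> (k < u)%N -> P i -> P k -> P j) ->
  exists i j, [/\ (s <= i <= r)%N, (r < j <= u)%N &
    \sum_(s <= t < u | P t) (d t.+1 - d t) = d j - d i].
Proof.
move=> /andP[sr ru] Pr Pconv; pose Q t := (s <= t < u)%N && P t.
have Qr : exists t, Q t by exists r; rewrite /Q sr ru.
have Qub t : Q t -> (t <= u)%N by case/andP=> /andP[_ /ltnW].
case: (ex_minnP Qr) => i /andP[/andP[si iu] Pi] imin.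
case: (ex_maxnP Qr Qub) => j /andP[/andP[sj ju] Pj] jmax.
have ir : (i <= r)%N by apply: imin; rewrite /Q sr ru.
have rj : (r <= j)%N by apply: jmax; rewrite /Q sr ru.
exists i, j.+1; rewrite si ir ltnS rj ju; split=> //.
rewrite (@big_cat_nat _ _ _ i) //= ?(ltnW iu) //.
rewrite (@big_cat_nat _ _ _ j.+1 i) //= ?(leq_trans (leq_trans ir rj)) //.
rewrite big_nat_cond big1 ?add0r; last first.
  move=> t /andP[/andP[st ti] Pt]; have := imin t.
  by rewrite /Q st (ltn_trans ti iu) Pt leqNgt ti => /(_ isT).
rewrite [X in _ + X]big_nat_cond [X in _ + X]big1 ?addr0; last first.
  move=> t /andP[/andP[jt tu] Pt]; have := jmax t.
  by rewrite /Q (leq_trans sj (ltnW jt)) tu Pt leqNgt jt => /(_ isT).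
rewrite big_nat_cond (eq_bigl (fun t => (i <= t < j.+1)%N)); last first.
  move=> t; case: (boolP (i <= t < j.+1)%N) => //= /andP[it tj].
  by apply: (Pconv i t j) => //; rewrite it -ltnS.
by rewrite -big_nat telescope_sumr // (leq_trans ir) // (leq_trans rj).
Qed.

(** * Deforming words by the increments of functions on the group *)

Section Deformation.
Variable F : T -> word -> nat.
Hypothesis F_weq : forall z g h, weq g h -> F z g = F z h.
Hypothesis F_letter : forall z g (l : letter), l.1 != z -> F z (rcons g l) = F z g.

(* [z ^ (n - m)] *)
Definition zpow z m n : word :=
  if (m <= n)%N then nseq (n - m) (z, false) else nseq (m - n) (z, true).

Lemma zpowE z m n :
  weq (zpow z m n) (inv_word (nseq m (z, false)) ++ nseq n (z, false)).
Proof.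
have invn k : inv_word (nseq k (z, false)) = nseq k (z, true).
  by rewrite /inv_word map_nseq rev_nseq.
rewrite /zpow; case: leqP => [mn|/ltnW nm].
  by rewrite -{2}(subnKC mn) nseqD catA weq_mulVr.
by rewrite -{2}(subnKC nm) nseqD inv_word_cat -catA weq_mulVr cats0 invn.
Qed.

Lemma zpow_cat z m n p : weq (zpow z m n ++ zpow z n p) (zpow z m p).
Proof.
rewrite !zpowE -catA (catA (nseq n _)); apply: weq_ctxl.
by rewrite weq_mulV.
Qed.

Lemma zpow_id z m : zpow z m m = [::].
Proof. by rewrite /zpow leqnn subnn. Qed.

Lemma all_zpow (P : pred T) z m n : P z -> all (fun l => P l.1) (zpow z m n).
Proof. by move=> Pz; rewrite /zpow; case: ifP => _; rewrite all_nseq /= Pz orbT. Qed.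

Fixpoint phi (g w : word) : word :=
  if w is l :: w' then zpow l.1 (F l.1 g) (F l.1 (rcons g l)) ++ phi (rcons g l) w'
  else [::].

Lemma phi_cat g u v : phi g (u ++ v) = phi g u ++ phi (g ++ u) v.
Proof.
by elim: u g => [|l u IH] g /=; rewrite ?cats0 // IH catA cat_rcons.
Qed.

Lemma phi_base g h w : weq g h -> phi g w = phi h w.
Proof.
elim: w g h => //= l w IH g h gh.
have ghl : weq (rcons g l) (rcons h l) by rewrite -!cats1 gh.
by rewrite (IH _ _ ghl) (F_weq _ gh) (F_weq _ ghl).
Qed.

(** By [F_weq] the two powers arising from a cancelling pair are inverse to each other. For
    commuting letters [F_letter] makes each increment the same in either order. *)
Lemma phi_weq g u v : weq u v -> weq (phi g u) (phi g v).
Proof.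
elim=> {u v} [_ _ [u w k b|u w k m b c km] | u | u v _ IH | u v w _ IH1 _ IH2].
- rewrite !phi_cat; apply: weq_ctxl; move: (g ++ u) => h /=.
  have hE : weq (rcons (rcons h (k, b)) (k, ~~ b)) h.
    rewrite -!cats1 -catA -[X in weq _ X]cats0; apply: weq_ctxl.
    exact: (weq_cancel (k, b)).
  rewrite (F_weq k hE) cats0 zpow_cat zpow_id /=.
  by rewrite -cat_rcons -cat_rcons cats0 (phi_base w hE).
- rewrite !phi_cat; apply: weq_ctxl; move: (g ++ u) => h /=.
  have mk : (m == k) = false by apply/negP => /eqP mkE; rewrite mkE e_irr in km.
  have hE : weq (rcons (rcons h (k, b)) (m, c)) (rcons (rcons h (m, c)) (k, b)).
    rewrite -!cats1 -!catA; apply: weq_ctxl.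
    exact: (@weq_swap (k, b) (m, c) km).
  have Fm0 : F m (rcons h (k, b)) = F m h by rewrite F_letter //= eq_sym mk.
  have Fk0 : F k (rcons h (m, c)) = F k h by rewrite F_letter //= mk.
  have Fm : F m (rcons (rcons h (k, b)) (m, c)) = F m (rcons h (m, c)).
    by rewrite (F_weq m hE) F_letter //= eq_sym mk.
  have Fk : F k (rcons (rcons h (m, c)) (k, b)) = F k (rcons h (k, b)).
    by rewrite -(F_weq k hE) F_letter //= mk.
  rewrite Fm Fm0 Fk Fk0 !cats0 -!cat_rcons !cats0 (phi_base w hE).
  apply/weq_ctxr/weq_comm_words.
  apply: (@all_zpow (fun x => all (fun y => e x y.1) _)).
  exact: (@all_zpow (e k)).
- by [].
- by symmetry.
- by rewrite IH1.
Qed.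

Lemma all_phi (P : pred T) g w :
  all (fun l => P l.1) w -> all (fun l => P l.1) (phi g w).
Proof.
by elim: w g => //= l w IH g /andP[Pl /IH Pw]; rewrite all_cat Pw all_zpow.
Qed.

Lemma meets_phi g a h b :
  meets g a h b -> meets (phi [::] g) a (phi [::] h) b.
Proof.
move=> [u [v [au bv uv]]]; exists (phi g u), (phi h v).
rewrite !(@all_phi (star _)) //; split=> //.
by have := phi_weq [::] uv; rewrite !phi_cat.
Qed.

Lemma acc_nseq z P x k b : (forall c, all (fun l => l.1 == z) c -> P (x ++ c) = P x) ->
  acc z P x (nseq k (z, b)) = if P x then (-1) ^+ b *+ k else 0.
Proof.
elim: k x => [|k IH] x Px /=; first by rewrite mulr0n; case: ifP.
have Px1 : P (rcons x (z, b)) = P x by rewrite -cats1 Px //= eqxx.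
rewrite eqxx IH ?Px1 /=; last first.
  by move=> c cz; rewrite cat_rcons Px //= eqxx.
by case: ifP => _; rewrite ?addr0 // mulrS.
Qed.

Lemma acc_zpow z P x m n : (forall c, all (fun l => l.1 == z) c -> P (x ++ c) = P x) ->
  acc z P x (zpow z m n) = if P x then n%:Z - m%:Z else 0.
Proof.
move=> Px; rewrite /zpow; case: leqP => [mn|/ltnW nm]; rewrite acc_nseq //;
  case: ifP => // _.
  by rewrite expr0 natz subzn.
by rewrite expr1 mulNrn natz -subzn // opprB.
Qed.

Variables (g w : word).
Let N := size w.
Let Y t := phi g (take t w).
Let d z t : int := (F z (g ++ take t w))%:Z.
Hypothesis d_convex : forall z s t u, (s <= t <= u)%N -> (u <= N)%N ->
  d z s = d z u -> d z t = d z s.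

Lemma take_rcons t : (t < N)%N -> exists l, take t.+1 w = rcons (take t w) l.
Proof.
rewrite /N; case: w => // l0 w' tN; exists (nth l0 (l0 :: w') t).
exact: take_nth.
Qed.

(** While the power of [z] contributed by one letter of [w] is read, the lower state is constant,
    since the head of [zs] is not [z]. Such a block counts with its full increment or not at all. *)
Lemma acc_phi z zs s t : sorted (fun x y => ~~ star x y) (z :: zs) -> (t <= N)%N ->
  acc z (eqst zs s) [::] (Y t) =
  \sum_(0 <= i < t | eqst zs s (Y i)) (d z i.+1 - d z i).
Proof.
move=> zzs; elim: t => [|t IH] tN; first by rewrite /Y take0 big_geq.
have [l tl] := take_rcons tN.
rewrite big_mkcond big_nat_recr //= -big_mkcond -IH ?(ltnW tN) //.
rewrite {1}/Y tl -cats1 phi_cat acc_cat /= cats0; congr (_ + _).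
rewrite -/(Y t) /d tl -rcons_cat.
have [lz|lz] := eqVneq l.1 z; last first.
  rewrite (@F_letter z) // subrr acc_off; last exact: (@all_zpow (fun x => x != z)).
  by case: ifP.
rewrite lz acc_zpow // => c cz; apply/eqst_eqr/eqst_off.
case: zs zzs {IH} => //= k zs /andP[zk _]; apply: sub_all cz => m /eqP->.
by apply: contraNneq zk => ->; rewrite /star eqxx.
Qed.

(** By [conv] the moments sharing the lower state of [r] form an interval, so the counter changes by
    [d z j - d z i] with [i <= r < j]. Were this zero, [d_convex] would make [d z] constant from [i]
    to [j], against the jump at [r]. *)
Lemma acc_phi_neq z zs s u r : sorted (fun x y => ~~ star x y) (z :: zs) ->
  (forall i j k, (i <= j <= k)%N -> (k <= N)%N ->
     eqst zs (Y i) (Y k) -> eqst zs (Y i) (Y j)) ->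
  (s <= r < u)%N -> (u <= N)%N -> d z r <> d z r.+1 ->
  acc z (eqst zs (Y r)) [::] (Y u) <> acc z (eqst zs (Y r)) [::] (Y s).
Proof.
move=> zzs conv /andP[sr ru] uN dr.
have su : (s <= u)%N by apply: leq_trans sr (ltnW ru).
rewrite !acc_phi // ?(leq_trans su) // (@big_cat_nat _ _ _ s 0 u) //=.
have [|||i [j [/andP[si ir] /andP[rj ju] ->]]] :=
  @convex_telescope (d z) (fun t => eqst zs (Y r) (Y t)) s u r.
- by rewrite sr.
- exact: eqst_refl.
- move=> i j k si /andP[ij jk] ku ri rk.
  have ik : eqst zs (Y i) (Y k) by apply: eqst_trans rk; rewrite eqst_sym.
  apply: (eqst_trans ri); apply: conv ik; first by rewrite ij.
  exact: leq_trans (ltnW ku) uN.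
move/eqP; rewrite -subr_eq0 addrAC subrr add0r subr_eq0 => /eqP dij.
have jN := leq_trans ju uN.
have ijr t : (i <= t <= j)%N -> d z t = d z i.
  by move=> itj; apply: (d_convex itj jN); rewrite dij.
by case: dr; rewrite !ijr // ?ir ?(ltnW rj) // rj (leq_trans ir).
Qed.

(** If the state at [i] recurs at [k], then [d z] has no jump in between by [acc_phi_neq], so the
    counters of [z] stay constant. *)
Lemma eqst_phi_convex zs i j k : sorted (fun x y => ~~ star x y) zs ->
  (i <= j <= k)%N -> (k <= N)%N ->
  eqst zs (Y i) (Y k) -> eqst zs (Y i) (Y j).
Proof.
elim: zs i j k => // z zs IH i j k zzs /andP[ij jk] kN /eqstP ik.
have zsS : sorted (fun x y => ~~ star x y) zs by case: (zs) zzs => //= ? ? /andP[].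
have dE r : (i <= r < k)%N -> d z r = d z r.+1.
  move=> irk; apply/eqP/negPn/negP => /eqP dr.
  by apply: (acc_phi_neq zzs _ irk kN dr) => // *; apply: IH; eauto.
apply/eqstP => s; have jN := leq_trans jk kN.
rewrite !acc_phi // ?(leq_trans ij) // [RHS](@big_cat_nat _ _ _ i 0 j) //=.
rewrite [X in _ + X]big_nat_cond [X in _ + X]big1 ?addr0 // => r.
case/andP=> /andP[ir rj] _; have irk : (i <= r < k)%N by rewrite ir (leq_trans rj).
by rewrite (dE r irk) subrr.
Qed.

(** The top counter for the lower state just before the last mark is nonzero on the deformed path
    but zero on [u]: at the first level the label is outside [star a], and at higher levels no
    prefix of [u] attains that lower state, by induction. *)
Lemma chain_phi a hs zs h t u :
  (forall h, h \in hs -> prefix (rcons h.1 h.2) w) ->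
  (forall h, h \in hs -> d h.2.1 (size h.1) <> d h.2.1 (size h.1).+1) ->
  chain a hs zs h -> (size h.1 < t <= N)%N -> all (fun l => star a l.1) u ->
  ~~ eqst zs (Y t) u.
Proof.
move=> pre cross ch; have := chain_sorted ch.
elim: ch t u => {zs h} [h hh ah | z zs h h' ch IH hh' hh pz] t u zzs /andP[ht tN] au;
    apply/negP => /eqstP/(_ (Y _)) E.
  have := @acc_phi_neq h.2.1 [::] 0 t (size h.1) zzs (fun _ _ _ _ _ _ => isT) ht tN (cross h hh).
  rewrite E acc_off; first by rewrite /Y take0.
  by apply: sub_all au => l; apply: contraL => /eqP->.
have zzs' : sorted (fun x y => ~~ star x y) (z :: zs) by case/andP: zzs.
have conv i j k : (i <= j <= k)%N -> (k <= N)%N ->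
    eqst (z :: zs) (Y i) (Y k) -> eqst (z :: zs) (Y i) (Y j).
  exact: eqst_phi_convex.
have := @acc_phi_neq h'.2.1 (z :: zs) 0 t (size h'.1) zzs conv ht tN (cross h' hh').
rewrite E acc_never; first by rewrite /Y take0.
move=> v vu; apply: IH => //.
  rewrite (leq_trans (ltnW ht) tN) andbT.
  by have := size_prefix hh; rewrite size_rcons.
by case/prefixP: vu au => v' ->; rewrite all_cat => /andP[].
Qed.

(** The letters of [v] lie in [star b] and so leave the top counter alone; [phi g w] would have the
    state of [u], against [chain_phi]. *)
Lemma phi_not_split a b hs u v :
  (forall h, h \in hs -> prefix (rcons h.1 h.2) w) ->
  (forall h, h \in hs -> d h.2.1 (size h.1) <> d h.2.1 (size h.1).+1) ->
  chained a b hs ->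
  all (fun l => star a l.1) u -> all (fun l => star b l.1) v ->
  ~ weq (phi g w) (u ++ v).
Proof.
move=> pre cross [zs [h [ch bh]]] au bv /(eqst_weq (chain_sorted ch)) E.
have hN : (size h.1 < N <= N)%N.
  by have := size_prefix (pre h (chain_mem ch)); rewrite size_rcons leqnn andbT.
have := chain_phi pre cross ch hN au; rewrite /Y /N take_size => /negP[].
apply: eqst_trans E _; apply: eqst_off.
rewrite (chain_head ch) /=; apply: sub_all bv => l.
by apply: contraL => /eqP->.
Qed.

End Deformation.

(** * Ranks from nested half-spaces *)

Local Open Scope nat_scope.

(* The half-space of the hyperplane [H] that does not contain [1]. *)
Definition nside (H : word * letter) (g : word) := side H g (+) side H [::].

Section Rank.
Variable L : seq (word * letter).

Definition endpoints : seq word := flatten [seq [:: H.1; H.1 ++ [:: H.2]] | H <- L].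

(** A total preorder standing in for inclusion: half-spaces are measured by the endpoints of marked
    edges that they contain. *)
Definition larger (H H' : word * letter) :=
  count (nside H') endpoints <= count (nside H) endpoints.

(* Larger half-spaces come first, so that among the half-spaces containing a
   given point the last one is innermost. *)
Definition ranked := sort larger L.

(** The shift by one leaves 0 for points in none of the half-spaces. *)
Definition rank (z : T) (g : word) : nat :=
  \max_(H <- ranked | (H.2.1 == z) && nside H g) (index H ranked).+1.

Lemma rank_weq z g h : weq g h -> rank z g = rank z h.
Proof. by move=> gh; apply: eq_bigl => H; rewrite /nside (side_weq H gh). Qed.

Lemma rank_letter z g (l : letter) : l.1 != z -> rank z (rcons g l) = rank z g.
Proof.
move=> lz; apply: eq_bigl => H; have [Hz|//] := eqVneq H.2.1 z.
by rewrite /nside -cats1 side_letter // Hz.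
Qed.

Lemma leq_rank z g H : H \in L -> H.2.1 = z -> nside H g ->
  index H ranked < rank z g.
Proof.
move=> HL Hz Hg; have Hr : H \in ranked by rewrite mem_sort.
by apply: (@leq_bigmax_seq _ _ _ (fun H => (index H ranked).+1) H) => //; rewrite Hz eqxx.
Qed.

Lemma rank_leq z g m :
  (forall H, H \in L -> H.2.1 = z -> nside H g -> index H ranked < m) ->
  rank z g <= m.
Proof.
move=> Hm; apply/bigmax_leqP_seq => H; rewrite mem_sort => HL /andP[/eqP Hz Hg].
exact: Hm.
Qed.

Lemma rank_size z g : rank z g <= size L.
Proof. by apply: rank_leq => H HL _ _; rewrite -(size_sort larger) index_mem mem_sort. Qed.

Lemma nside_convex H g u v : reduced (u ++ v) ->
  nside H (g ++ u ++ v) = nside H g -> nside H (g ++ u) = nside H g.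
Proof. by rewrite /nside => uv /addIb E; congr addb; apply: side_convex E. Qed.

(** By convexity of complements, a half-space containing the middle point contains one of the ends.
    Conversely, the half-spaces attaining the common rank at both ends have the same index, hence
    coincide, and by convexity contain the middle point. *)
Lemma rank_convex z g u v : reduced (u ++ v) ->
  rank z (g ++ u ++ v) = rank z g -> rank z (g ++ u) = rank z g.
Proof.
move=> uv E; apply/eqP; rewrite eqn_leq; apply/andP; split.
  apply: rank_leq => H HL Hz; have := nside_convex (H := H) (g := g) uv.
  case: (boolP (nside H g)) => [Hg _ _|_]; first exact: leq_rank.
  case: (boolP (nside H (g ++ u ++ v))) => [Hguv _ _|_ ->] //.
  by rewrite -E; apply: leq_rank.
case: (posnP (rank z g)) => [-> //|g0].
have [H [Hr /andP[/eqP Hz Hg] HE]] := bigmax_attained g0.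
have [|H' [Hr' /andP[_ Hg'] HE']] := @bigmax_attained _ ranked
  (fun H => (H.2.1 == z) && nside H (g ++ u ++ v)) (fun H => (index H ranked).+1).
  by rewrite -/(rank _ _) E.
have HH : H' = H.
  apply: (@index_inj _ H ranked) => //.
  by apply: succn_inj; rewrite HE HE' -!/(rank _ _).
rewrite /rank -HE; apply: leq_rank; rewrite ?(nside_convex uv) //.
  by rewrite -(mem_sort larger).
by rewrite Hg -HH.
Qed.

(** Complements of the half-spaces are convex and contain 1, so a reduced path from 1 never leaves a
    half-space that it has entered. *)
Lemma rank_mono z w l : reduced (rcons w l) -> rank z w <= rank z (rcons w l).
Proof.
move=> wl; apply: rank_leq => H HL Hz Hw; apply: leq_rank => //.
apply: contraLR Hw => Hwl.
have n1 : nside H [::] = false by rewrite /nside addbb.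
have := @nside_convex H [::] w [:: l]; rewrite cats1 /= n1 => -> //.
exact: negbTE.
Qed.

Lemma nside_edge H H' :
  nside H' H.1 = nside H' (H.1 ++ [:: H.2]) \/ nside H' =1 nside H.
Proof.
have [E|/side_parallel[b HE]] := eqVneq (side H' H.1) (side H' (H.1 ++ [:: H.2])).
  by left; rewrite /nside E.
by right=> g; rewrite /nside !HE; case: b {HE}; case: side; case: side.
Qed.

(** The points 1, [x] and [y] occupy three of the four quadrants; a [g] in [nside H] only would fill
    the fourth, against [side_quadrants]. *)
Lemma nside_laminar H H' x y : H.2.1 = H'.2.1 ->
  nside H x -> nside H' x -> nside H' y -> ~~ nside H y ->
  forall g, nside H g -> nside H' g.
Proof.
move=> HH' Hx H'x H'y Hy g Hg; apply/negPn/negP => H'g.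
apply: (side_quadrants HH') => b b'.
have n1 K : nside K [::] = false by rewrite /nside addbb.
pose s K (c : bool) := c (+) side K [::].
suff [k [kH kH']] : exists k, nside H k = s H b /\ nside H' k = s H' b'.
  by exists k; move: kH kH'; rewrite /nside /s => /addIb-> /addIb->.
case: (s H b); case: (s H' b').
- by exists x.
- by exists g; rewrite Hg (negbTE H'g).
- by exists y; rewrite H'y (negbTE Hy).
by exists [::]; rewrite !n1.
Qed.

(** Here [x] and [y] are to be the ends of an edge dual to [H]. A half-space of the same label
    containing [y] also contains [x], hence all of [nside H] by laminarity, and the endpoint [y]
    besides; so it strictly precedes [H] in [ranked]. *)
Lemma rank_lt H x y : H \in L -> y \in endpoints -> nside H x -> ~~ nside H y ->
  (forall H', nside H' x = nside H' y \/ nside H' =1 nside H) ->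
  rank H.2.1 y < rank H.2.1 x.
Proof.
move=> HL yE Hx Hy edge; apply: leq_ltn_trans (leq_rank HL erefl Hx).
apply: rank_leq => H' HL' HH' H'y; rewrite ltnNge; apply/negP => HH.
case: (edge H') => [xy|E]; last by rewrite -E H'y in Hy.
have tot : total larger by move=> A B; apply: leq_total.
have tr : transitive larger by move=> A B C AB BC; apply: leq_trans BC AB.
have := sorted_leq_index tr (fun A => leqnn _) (sort_sorted tot L).
move=> /(_ H H'); rewrite !mem_sort => /(_ HL HL' HH); apply/negP.
have sub := nside_laminar (esym HH') Hx (etrans xy H'y) H'y Hy.
rewrite -ltnNge.
elim: endpoints yE => //= k s IH; rewrite inE => /orP[/eqP<-|/IH lt].
  by rewrite (negbTE Hy) H'y add0n ltnS; apply: sub_count.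
rewrite -addnS; apply: leq_add => //.
by case: (boolP (nside H k)) => // /sub->.
Qed.

Lemma rank_cross H : H \in L -> rank H.2.1 H.1 <> rank H.2.1 (rcons H.1 H.2).
Proof.
move=> HL; rewrite -cats1; have edge := nside_edge H.
have [nE fE] : H.1 \in endpoints /\ H.1 ++ [:: H.2] \in endpoints.
  by split; apply/flatten_mapP; exists H; rewrite // !inE eqxx ?orbT.
have : nside H H.1 != nside H (H.1 ++ [:: H.2]).
  by rewrite /nside side_near side_far; case: side.
case: (boolP (nside H H.1)) => Hn; case: (boolP (nside H (H.1 ++ _))) => // Hf _ E.
  by have := rank_lt HL fE Hn Hf edge; rewrite E ltnn.
have := @rank_lt H _ H.1 HL nE Hf Hn; rewrite E ltnn => /(_ _)/notF; apply.
by move=> H'; case: (edge H') => E'; [left | right].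
Qed.

(** Ranks do not decrease along a reduced path from 1, so the lengths of the powers telescope. *)
Lemma size_phi_rank w : reduced w -> size (phi rank [::] w) <= \sum_z rank z w.
Proof.
elim/last_ind: w => //= w l IH wl.
have lt : rank l.1 w <= rank l.1 (rcons w l) by apply: rank_mono.
rewrite -cats1 phi_cat /= cats0 size_cat /zpow lt size_nseq cats1.
rewrite (bigD1 l.1) //= -[X in _ <= X + _](subnKC lt) addnAC leq_add2r.
rewrite (eq_bigr (fun z => rank z w)); last first.
  by move=> z zl; rewrite rank_letter // eq_sym.
rewrite -(bigD1 l.1 (P := predT) (F := fun z => rank z w)) //=; apply: IH.
by move: wl; rewrite -cats1; apply: reduced_catl.
Qed.

End Rank.

(** * Bounded representatives of the cosets *)

Lemma bounded_deformation (D : finType) (g : D -> word) (a : D -> T) :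
  (forall i, reduced (g i)) ->
  exists g' : D -> word,
    (forall i, size (g' i) <= #|T| * (#|D| * #|D| * #|T|)) /\
    forall i j, meets (g' i) (a i) (g' j) (a j) <-> meets (g i) (a i) (g j) (a j).
Proof.
move=> gr; pose w (p : D * D) := nf (inv_word (g p.1) ++ g p.2).
have gw i j : weq (g i ++ w (i, j)) (g j) by rewrite /w nf_weq catA weq_mulV.
have /fin_all_exists[hs hsP] (p : D * D) : exists hs : seq (word * letter),
    [/\ size hs <= #|T|, forall h, h \in hs -> prefix (rcons h.1 h.2) (w p) &
        meets (g p.1) (a p.1) (g p.2) (a p.2) \/ chained (a p.1) (a p.2) hs].
  case: p => i j; have [[u [v [au bv uv]]]|[hs [? ? ?]]] :=
    split_or_chained (a i) (a j) (w (i, j)); last by exists hs; split=> //; right.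
  exists [::]; split=> //; left; exists u, (inv_word v).
  rewrite (all_inv_word (star _)); split=> //=.
  by rewrite -(gw i j) uv -!catA weq_mulV cats0.
(* Left translation by [g p.1] places the marked edges of [w p] on the path from [g p.1] to
   [g p.2]. *)
pose L := flatten [seq [seq (g p.1 ++ h.1, h.2) | h <- hs p] | p <- enum {: D * D}].
have LP p h : h \in hs p -> (g p.1 ++ h.1, h.2) \in L.
  by move=> hp; apply/flatten_mapP; exists p; rewrite ?mem_enum //; apply: map_f.
exists (fun i => phi (rank L) [::] (g i)); split=> [i|i j].
  apply: leq_trans (size_phi_rank L (gr i)) _.
  rewrite -sum_nat_const; apply: leq_sum => z _.
  apply: leq_trans (rank_size L z (g i)) _; rewrite -card_prod cardE.
  by apply: size_flatten_leq => p; rewrite size_map; case: (hsP p).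
split; last exact: (meets_phi (@rank_weq L) (@rank_letter L)).
(* If the deformed cosets met but the original ones did not, the deformed [w (i, j)] would equal
   [u ++ inv_word v], which [phi_not_split] excludes. *)
move=> [u [v [au bv uv]]]; have [_ pre [//|ch]] := hsP (i, j).
exfalso; apply: (@phi_not_split (rank L) (@rank_letter L) (g i) (w (i, j)) _
  (a i) (a j) (hs (i, j)) u (inv_word v)) => //.
- move=> z s t k /andP[st tk] kN [E]; congr Posz.
  (* [W] is cut at [s], [t] and [k]; [rank_convex] applies to the reduced piece from [s] to [k]. *)
  set W := w (i, j) in kN E *; set V := drop s W.
  have tE : take t W = take s W ++ take (t - s) V by rewrite -takeD subnKC.
  have kE : take k W = take s W ++ take (t - s) V ++ take (k - t) (drop (t - s) V).
    by rewrite -!takeD addnA !subnKC.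
  rewrite tE catA; apply: (@rank_convex L z _ _ (take (k - t) (drop (t - s) V))); last first.
    by rewrite -!catA -kE -E.
  rewrite -takeD; have : reduced W by apply: nf_reduced.
  rewrite -(cat_take_drop s W) => /reduced_catr; rewrite -/V.
  by rewrite -{1}(cat_take_drop (t - s + (k - t)) V) => /reduced_catl.
- move=> h hh; have /prefixP[r wE] := pre h hh.
  rewrite wE -cats1 -catA take_size_cat // cat1s -cat_rcons.
  rewrite take_size_cat ?size_rcons // -rcons_cat => -[].
  exact: (@rank_cross L (g i ++ h.1, h.2) (LP _ h hh)).
- by rewrite (all_inv_word (star _)).
have := phi_weq (@rank_weq L) (@rank_letter L) [::] (gw i j).
rewrite phi_cat /= => E; move: uv; rewrite -E -catA => /weq_canl.
rewrite catA weq_mulVr /= => uE.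
by rewrite uE -catA weq_mulV cats0.
Qed.

End NormalForm.

(** * Transfer to the extension graph *)

Lemma num_components_gt0 (D : finType) (eD : rel D) :
  symmetric eD -> D -> 0 < num_components eD.
Proof.
move=> sD i; apply/card_gt0P; exists (root (connect eD) i); rewrite !inE.
(* [num_components] passes [connect eD] to [n_comp], which takes connectivity once more, so symmetry
   is transferred twice. *)
by rewrite roots_root //; apply/sym_connect_sym/sym_connect_sym.
Qed.

Theorem theorem3p1 (D : finType) (eD : rel D) (T : finType) (e : rel T) :
  simple_graph eD -> simple_graph e ->
  let n := #|D| in let M := #|T| in let K := num_components eD in
  let R := 4 * K * n ^ 2 * M ^ K.+1 in
  induced_in_ext eD e (fun _ => True) ->
  induced_in_ext eD e (ball_vertex e R).
Proof.
move=> [sD _] [sT iT] n M K R [f [fV [f_inj f_adj]]].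
have /fin_all_exists2[g gr /fin_all_exists[a fE]] (i : D) :
    exists2 g, reduced e g & exists a, weq e (f i) (wconj g a).
  (* [ext_vertex] puts the inverse on the left and [wconj] on the right, so the coset representative
     is the inverse of [g]. *)
  have [[g [a fE]] _] := fV i; exists (nf e (inv_word g)).
    exact: nf_reduced.
  exists a; rewrite fE (conj_weq (nf_weq sT (inv_word g)) (erefl a)) /wconj inv_wordK.
  exact: weq_refl.
have [g' [sz_g' g'P]] := bounded_deformation sT iT a gr.
have equiv i j : weq e (f i) (f j) <->
    weq e (wconj (g' i) (a i)) (wconj (g' j) (a j)).
  by rewrite !fE !weq_conj // g'P.
exists (fun i => wconj (g' i) (a i)); split; [|split].
- move=> i; split.
    by exists (inv_word (g' i)), (a i); rewrite inv_wordK; apply: weq_refl.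
  exists (g' i), (a i); split; last exact: weq_refl.
  apply: leq_trans (sz_g' i) _.
  (* The vertex [i] makes [K] and [M] positive, so [M ^ 2 <= M ^ K.+1] and the bound [n ^ 2 * M ^ 2]
     is at most [R]. *)
  have K0 : 0 < K by apply: num_components_gt0 i.
  have M0 : 0 < M by apply/card_gt0P; exists (a i).
  have -> : M * (n * n * M) = n ^ 2 * M ^ 2 by rewrite mulnC -mulnA -!mulnn.
  apply: leq_mul; first by rewrite leq_pmull // muln_gt0.
  by apply: leq_pexp2l.
- by move=> i j /equiv/f_inj.
move=> i j; rewrite f_adj ext_adj_conj // g'P -ext_adj_conj //.
by rewrite /ext_adj !fE.
Qed.
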